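(* Let $\mathfrak{B}$ be a unital C$^*$-algebra, let $I\subseteq\mathbb{Z}$ be a totally ordered index set, let $(\mathcal{E}_i)_{i\in I}$ be a family of semi-inner product $\mathfrak{B}$-bimodules, and let $\mathcal{E}^{wm}$ be their weakly monotone product. For $i\in I$ let $\mathfrak{A}_i$ be the algebra generated over $\mathfrak{B}$ by the operators $G(f)=a(f)+a^*(f)$, $f\in\mathcal{E}_i$, on $\mathcal{E}^{wm}$. Then the algebras $\{\mathfrak{A}_i\}_{i\in I}$ are monotonically independent over $\mathfrak{B}$ with respect to the $\mathfrak{B}$-valued functional $\Phi(\cdot)=\langle1,\cdot\,1\rangle$.
   Context: A semi-inner product $\mathfrak{B}$-bimodule is a $\mathfrak{B}$-bimodule $\mathcal{E}$ with a map $\langle\cdot,\cdot\rangle:\mathcal{E}\times\mathcal{E}\to\mathfrak{B}$, linear in the second variable, with $\langle x,ya\rangle=\langle x,y\rangle a$, $\langle y,x\rangle=\langle x,y\rangle^*$, $\langle x,x\rangle\ge0$, and $\langle ax,y\rangle=\langle x,a^*y\rangle$ for $x,y\in\mathcal{E}$, $a\in\mathfrak{B}$. $\mathfrak{B}$ itself is a bimodule with $\langle a,b\rangle=a^*b$. Weakly monotone product. With all tensor products over $\mathfrak{B}$, and direct sums algebraic and orthogonal, $$\mathcal{E}^{wm}=\mathfrak{B}\oplus\bigoplus_{n\ge1}\ \bigoplus_{\substack{i_1,\dots,i_n\in I\\ i_1\ge\dots\ge i_n}}\mathcal{E}_{i_1}\otimes\cdots\otimes\mathcal{E}_{i_n},$$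 with $\langle f_1\otimes\cdots\otimes f_n,e_1\otimes\cdots\otimes e_m\rangle=\delta_{m,n}\langle f_n,\langle f_{n-1},\dots\langle f_1,e_1\rangle\cdots e_{n-1}\rangle e_n\rangle$ (summands with different index tuples being orthogonal); $1$ is the unit of $\mathfrak{B}\subset\mathcal{E}^{wm}$. For $f\in\mathcal{E}_i$ the right-$\mathfrak{B}$-linear creation and annihilation maps on $\mathcal{E}^{wm}$ are determined, for $f_{i_k}\in\mathcal{E}_{i_k}$, by: $a^*(f)1=f$; $a^*(f)f_{i_1}\otimes\cdots\otimes f_{i_n}=f\otimes f_{i_1}\otimes\cdots\otimes f_{i_n}$ if $i\ge i_1$ and $0$ if $i<i_1$; $a(f)1=0$; $a(f)f_{i_1}\otimes\cdots\otimes f_{i_n}=\langle f,f_{i_1}\rangle f_{i_2}\otimes\cdots\otimes f_{i_n}$ if $i=i_1$ (this being $\langle f,f_{i_1}\rangle\in\mathfrak{B}$ when $n=1$) and $0$ if $i\ne i_1$. $\mathfrak{B}$ acts on $\mathcal{E}^{wm}$ by left multiplication. The algebra $\mathfrak{A}_i$ is the linear span of all words $b_0G(f_1)b_1\cdots G(f_n)b_n$ with $n\ge1$, $f_l\in\mathcal{E}_i$, $b_l\in\mathfrak{B}$, a subalgebra of the algebra $\mathfrak{A}$ of all right-$\mathfrak{B}$-linear operators on $\mathcal{E}^{wm}$. Monotonic independence. A family $\{\mathfrak{A}_j\}_{j\in I}$ of subalgebras of $\mathfrak{A}$ is monotonically independent over $\mathfrak{B}$ with respect to $\Phi:\mathfrak{A}\to\mathfrak{B}$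 if: (a) for all $i<j>k$ in $I$, all $X_i\in\mathfrak{A}_i$, $X_j\in\mathfrak{A}_j$, $X_k\in\mathfrak{A}_k$ and all $A,B\in\mathfrak{A}$, $\Phi(AX_iX_jX_kB)=\Phi(AX_i\Phi(X_j)X_kB)$; (b) for all $i_m>\dots>i_1<k_1<\dots<k_n$ in $I$ and all $X_l\in\mathfrak{A}_l$: $\Phi(X_{i_m}\cdots X_{i_1})=\Phi(X_{i_m})\cdots\Phi(X_{i_1})$, $\Phi(X_{k_1}\cdots X_{k_n})=\Phi(X_{k_1})\cdots\Phi(X_{k_n})$, and $\Phi(X_{i_m}\cdots X_{i_1}X_{k_1}\cdots X_{k_n})=\Phi(X_{i_m})\cdots\Phi(X_{i_1})\Phi(X_{k_1})\cdots\Phi(X_{k_n})$. *)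

(* Defs.v *)
From HB Require Import structures.
From mathcomp Require Import all_boot all_order all_algebra finmap.
From mathcomp Require Import complex all_classical reals.

Set Implicit Arguments.
Unset Strict Implicit.
Unset Printing Implicit Defensive.

Import Order.TTheory GRing.Theory Num.Theory.

Local Open Scope ring_scope.
Local Open Scope complex_scope.
Local Open Scope classical_set_scope.

(* The norm is a field of its own, rather than the one of normedModType,
   because Hierarchy Builder has no join of rings and normed modules. *)
HB.mixin Record isCStarAlgebra (R : realType) B & GRing.Algebra R[i] B := {
  star : B -> B;
  cnorm : B -> R;
  starZD : forall (c : R[i]) (a b : B),
    star (c *: a + b) = c^*%C *: star a + star b;
  starM : forall a b : B, star (a * b) = star b * star a;
  starK : involutive star;
  cnorm0_eq0 : forall a : B, cnorm a = 0 -> a = 0;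
  cnormD : forall a b : B, cnorm (a + b) <= cnorm a + cnorm b;
  cnormZ : forall (c : R[i]) (a : B), (cnorm (c *: a))%:C = `|c| * (cnorm a)%:C;
  cnormM : forall a b : B, cnorm (a * b) <= cnorm a * cnorm b;
  cnorm_star : forall a : B, cnorm (star a * a) = cnorm a ^+ 2;
  cnorm_complete : forall u : nat -> B,
    (forall e : R, 0 < e -> exists N, forall m n, (N <= m)%N -> (N <= n)%N ->
       cnorm (u m - u n) < e) ->
    exists l : B, forall e : R, 0 < e ->
      exists N, forall n, (N <= n)%N -> cnorm (u n - l) < e
}.

#[short(type="cstarAlgType")]
HB.structure Definition CStarAlgebra (R : realType) :=
  {B of GRing.Algebra R[i] B & isCStarAlgebra R B}.

Definition in_spectrum (R : realType) (B : cstarAlgType R) (b : B) (l : R[i]) :=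
  ~ exists c : B, c * (l%:A - b) = 1 /\ (l%:A - b) * c = 1.

(* In the order of R[i], 0 <= l says that l is real and nonnegative. *)
Definition cstar_ge0 (R : realType) (B : cstarAlgType R) (b : B) :=
  star b = b /\ forall l : R[i], in_spectrum b l -> 0 <= l.

Reserved Notation "a *> x" (at level 39, left associativity).
Reserved Notation "x <* a" (at level 39, left associativity).

HB.mixin Record isBimodule (R : realType) (B : cstarAlgType R) E
    & GRing.Lmodule R[i] E := {
  lact : B -> E -> E;
  ract : E -> B -> E;
  lact_linear : forall a, linear (lact a);
  lact_linearl : forall x, linear (fun a => lact a x);
  ract_linear : forall a, linear (fun x => ract x a);
  ract_linearr : forall x, linear (ract x);
  lact1 : forall x, lact 1 x = x;
  ract1 : forall x, ract x 1 = x;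
  lactA : forall a b x, lact (a * b) x = lact a (lact b x);
  ractA : forall a b x, ract x (a * b) = ract (ract x a) b;
  lractA : forall a b x, lact a (ract x b) = ract (lact a x) b
}.

#[short(type="bimodType")]
HB.structure Definition Bimodule (R : realType) (B : cstarAlgType R) :=
  {E of GRing.Lmodule R[i] E & isBimodule R B E}.

Notation "a *> x" := (lact a x) : ring_scope.
Notation "x <* a" := (ract x a) : ring_scope.

(* All the axioms of a semi-inner product except positivity. These are the ones
   that make the recursive formula for the form on a tensor product well
   defined, and they pass to tensor products and direct sums by mere algebra. *)
HB.mixin Record isFormBimodule (R : realType) (B : cstarAlgType R) E
    & Bimodule R B E := {
  ip : E -> E -> B;
  ip_linear : forall x, linear (ip x);
  ip_ract : forall x y a, ip x (y <* a) = ip x y * a;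
  ip_star : forall x y, ip y x = star (ip x y);
  ip_lact : forall x y a, ip (a *> x) y = ip x (star a *> y)
}.

#[short(type="formBimodType")]
HB.structure Definition FormBimodule (R : realType) (B : cstarAlgType R) :=
  {E of Bimodule R B E & isFormBimodule R B E}.

HB.mixin Record isSemiInnerBimodule (R : realType) (B : cstarAlgType R) E
    & FormBimodule R B E := {
  ip_ge0 : forall x : E, cstar_ge0 (ip x x)
}.

#[short(type="semiInnerBimodType")]
HB.structure Definition SemiInnerBimodule (R : realType) (B : cstarAlgType R) :=
  {E of FormBimodule R B E & isSemiInnerBimodule R B E}.

Section CStarTheory.
Context {R : realType} {B : cstarAlgType R}.
Implicit Types (a b : B) (c : R[i]).

Lemma starD a b : star (a + b) = star a + star b.
Proof.
by have := starZD 1 a b; rewrite conjc1 !scale1r.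
Qed.

Lemma star0 : star 0 = 0 :> B.
Proof. by apply: (addrI (star 0)); rewrite -starD !addr0. Qed.

Lemma starZ c a : star (c *: a) = c^*%C *: star a.
Proof. by have := starZD c a 0; rewrite star0 !addr0. Qed.

Lemma star1 : star 1 = 1 :> B.
Proof. by rewrite -[RHS]starK -[in RHS](mul1r (star 1)) starM starK mul1r. Qed.

Lemma star_sum I (r : seq I) (P : pred I) (F : I -> B) :
  star (\sum_(i <- r | P i) F i) = \sum_(i <- r | P i) star (F i).
Proof. exact: (big_morph _ starD star0). Qed.

End CStarTheory.

Section BimoduleTheory.
Context {R : realType} {B : cstarAlgType R}.

Section Actions.
Context {E : bimodType B}.
Implicit Types (x y : E) (a b : B) (c : R[i]).

Lemma lactD a x y : a *> (x + y) = a *> x + a *> y.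
Proof. by have := lact_linear a 1 x y; rewrite !scale1r. Qed.
Lemma lact0 a : a *> (0 : E) = 0.
Proof. by apply: (addrI (a *> 0)); rewrite -lactD !addr0. Qed.
Lemma lactZ a c x : a *> (c *: x) = c *: (a *> x).
Proof. by have := lact_linear a c x 0; rewrite lact0 !addr0. Qed.
Lemma lactDl a b x : (a + b) *> x = a *> x + b *> x.
Proof. by have := lact_linearl x 1 a b; rewrite /= !scale1r. Qed.
Lemma lact0l x : 0 *> x = 0.
Proof. by apply: (addrI (0 *> x)); rewrite -lactDl !addr0. Qed.
Lemma lactZl a c x : (c *: a) *> x = c *: (a *> x).
Proof. by have := lact_linearl x c a 0; rewrite /= lact0l !addr0. Qed.
Lemma ractD x y a : (x + y) <* a = x <* a + y <* a.
Proof. by have := ract_linear a 1 x y; rewrite /= !scale1r. Qed.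
Lemma ract0 a : (0 : E) <* a = 0.
Proof. by apply: (addrI (0 <* a)); rewrite -ractD !addr0. Qed.
Lemma ractZ a c x : (c *: x) <* a = c *: (x <* a).
Proof. by have := ract_linear a c x 0; rewrite /= ract0 !addr0. Qed.
Lemma ractDr x a b : x <* (a + b) = x <* a + x <* b.
Proof. by have := ract_linearr x 1 a b; rewrite !scale1r. Qed.
Lemma ract0r x : x <* 0 = 0.
Proof. by apply: (addrI (x <* 0)); rewrite -ractDr !addr0. Qed.
Lemma ractZr x c a : x <* (c *: a) = c *: (x <* a).
Proof. by have := ract_linearr x c a 0; rewrite ract0r !addr0. Qed.

Lemma lact_sum I (r : seq I) (P : pred I) (F : I -> E) a :
  a *> (\sum_(i <- r | P i) F i) = \sum_(i <- r | P i) a *> F i.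
Proof. exact: (big_morph _ (lactD a) (lact0 a)). Qed.
Lemma ract_sum I (r : seq I) (P : pred I) (F : I -> E) a :
  (\sum_(i <- r | P i) F i) <* a = \sum_(i <- r | P i) F i <* a.
Proof. exact: (big_morph (fun x => x <* a) (fun x y => ractD x y a) (ract0 a)). Qed.

End Actions.

Section Forms.
Context {E : formBimodType B}.
Implicit Types (x y z : E) (a b : B) (c : R[i]).

Lemma ipDr x y z : ip x (y + z) = ip x y + ip x z.
Proof. by have := ip_linear x 1 y z; rewrite !scale1r. Qed.
Lemma ip0r x : ip x 0 = 0.
Proof. by apply: (addrI (ip x 0)); rewrite -ipDr !addr0. Qed.
Lemma ipZr x c y : ip x (c *: y) = c *: ip x y.
Proof. by have := ip_linear x c y 0; rewrite ip0r !addr0. Qed.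
Lemma ipDl x y z : ip (x + y) z = ip x z + ip y z.
Proof. by rewrite [LHS]ip_star ipDr starD -!ip_star. Qed.
Lemma ip0l x : ip 0 x = 0.
Proof. by rewrite ip_star ip0r star0. Qed.
Lemma ip_ractl x y a : ip (x <* a) y = star a * ip x y.
Proof. by rewrite [LHS]ip_star ip_ract starM -ip_star. Qed.

End Forms.
End BimoduleTheory.

Section SelfBimodule.
Context {R : realType} (B : cstarAlgType R).

Definition self_bimod : Type := B.

HB.instance Definition _ := GRing.Lmodule.on self_bimod.

Let lact_self (a : B) (x : self_bimod) : self_bimod := a * (x : B).
Let ract_self (x : self_bimod) (a : B) : self_bimod := (x : B) * a.
Let ip_self (x y : self_bimod) : B := star (x : B) * (y : B).

Let lact_self_linear a : linear (lact_self a).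
Proof. by move=> c x y; rewrite /lact_self mulrDr -scalerAr. Qed.
Let lact_self_linearl x : linear (fun a => lact_self a x).
Proof. by move=> c a b; rewrite /lact_self mulrDl -scalerAl. Qed.
Let ract_self_linear a : linear (fun x => ract_self x a).
Proof. by move=> c x y; rewrite /ract_self mulrDl -scalerAl. Qed.
Let ract_self_linearr x : linear (ract_self x).
Proof. by move=> c a b; rewrite /ract_self mulrDr -scalerAr. Qed.

HB.instance Definition _ := isBimodule.Build R B self_bimod
  lact_self_linear lact_self_linearl ract_self_linear ract_self_linearr
  (fun x => mul1r (x : B)) (fun x => mulr1 (x : B))
  (fun a b x => esym (mulrA a b (x : B))) (fun a b x => mulrA (x : B) a b)
  (fun a b x => mulrA a (x : B) b).

Let ip_self_linear x : linear (ip_self x).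
Proof. by move=> c y z; rewrite /ip_self mulrDr -scalerAr. Qed.
Let ip_self_ract x (y : self_bimod) a : ip_self x (y <* a) = ip_self x y * a.
Proof. exact: mulrA. Qed.
Let ip_self_star x y : ip_self y x = star (ip_self x y).
Proof. by rewrite /ip_self starM starK. Qed.
Let ip_self_lact (x y : self_bimod) a :
  ip_self (a *> x) y = ip_self x (star a *> y).
Proof. by rewrite /ip_self /lact /= /lact_self starM mulrA. Qed.

HB.instance Definition _ := isFormBimodule.Build R B self_bimod
  ip_self_linear ip_self_ract ip_self_star ip_self_lact.

End SelfBimodule.

Section TensorProduct.
Local Open Scope quotient_scope.
Context {R : realType} {B : cstarAlgType R} (E F : bimodType B).
Implicit Types (s t : seq (E * F)).

(* A sequence of pairs (x_k, y_k) stands for the formal sum of the x_k (x) y_k.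
   Concatenation is the sum; the opposite of (x, y) is (- x, y). *)
Inductive tens_eqv : seq (E * F) -> seq (E * F) -> Prop :=
| tens_refl s : tens_eqv s s
| tens_sym s t : tens_eqv s t -> tens_eqv t s
| tens_trans s t u : tens_eqv s t -> tens_eqv t u -> tens_eqv s u
| tens_cat s s' t t' :
    tens_eqv s s' -> tens_eqv t t' -> tens_eqv (s ++ t) (s' ++ t')
| tens_catC s t : tens_eqv (s ++ t) (t ++ s)
| tens_zero y : tens_eqv [:: (0, y)] [::]
| tens_addl x x' y : tens_eqv [:: (x + x', y)] [:: (x, y); (x', y)]
| tens_addr x y y' : tens_eqv [:: (x, y + y')] [:: (x, y); (x, y')]
| tens_bal x b y : tens_eqv [:: (x <* b, y)] [:: (x, b *> y)].

Definition tens_rel : rel (seq (E * F)) := fun s t => `[< tens_eqv s t >].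

Fact tens_rel_equiv : equiv_class_of tens_rel.
Proof.
split=> [s|s t|t s u]; first exact/asboolP/tens_refl.
  by apply/asboolP/asboolP; apply: tens_sym.
by move=> /asboolP st /asboolP tu; apply/asboolP; apply: tens_trans st tu.
Qed.

Canonical tens_equiv := EquivRelPack tens_rel_equiv.

Definition tensor : Type := {eq_quot tens_equiv}.

HB.instance Definition _ := EqQuotient.on tensor.
HB.instance Definition _ := Choice.on tensor.

Definition tens_class s : tensor := \pi s.

Lemma tens_classP s t : tens_class s = tens_class t <-> tens_eqv s t.
Proof.
split=> [/eqmodP/asboolP //|st]; apply/eqmodP; exact/asboolP.
Qed.

Definition tens_pure (x : E) (y : F) : tensor := tens_class [:: (x, y)].

Section Lift.
Variable G : nmodType.

Definition balanced (phi : E -> F -> G) :=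
  [/\ forall y, {morph phi^~ y : x x' / x + x'},
      forall x, {morph phi x : y y' / y + y'},
      forall y, phi 0 y = 0
    & forall x b y, phi (x <* b) y = phi x (b *> y)].

Definition tens_lift (phi : E -> F -> G) (u : tensor) : G :=
  \sum_(p <- repr u) phi p.1 p.2.

Lemma tens_lift_class phi s : balanced phi ->
  tens_lift phi (tens_class s) = \sum_(p <- s) phi p.1 p.2.
Proof.
case=> pl pr p0 pb; rewrite /tens_lift.
have: tens_eqv (repr (tens_class s)) s by apply/tens_classP; rewrite /tens_class reprK.
move: (repr _) => r; elim=> {r s} [s|s t _ ->|s t u _ -> _ ->|s s' t t' _ es _ et|s t|y|x x' y|x y y'|x b y] //.
- by rewrite !big_cat es et.
- by rewrite !big_cat /= addrC.
- by rewrite big_seq1 big_nil.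
- by rewrite big_seq1 big_cons big_seq1 pl.
- by rewrite big_seq1 big_cons big_seq1 pr.
- by rewrite !big_seq1 pb.
Qed.

Lemma tens_lift_pure phi x y : balanced phi ->
  tens_lift phi (tens_pure x y) = phi x y.
Proof. by move=> h; rewrite tens_lift_class // big_seq1. Qed.

End Lift.

Let tadd (u v : tensor) := tens_class (repr u ++ repr v).
Let topp (u : tensor) := tens_class [seq (- p.1, p.2) | p <- repr u].
Let tzero := tens_class [::].

Let taddE s t : tadd (tens_class s) (tens_class t) = tens_class (s ++ t).
Proof.
by apply/tens_classP/tens_cat; apply/tens_classP; rewrite /tens_class reprK.
Qed.

Let tclassK u : tens_class (repr u) = u.
Proof. by rewrite /tens_class reprK. Qed.

Let taddA : associative tadd.
Proof.
move=> u v w; rewrite -(tclassK u) -(tclassK v) -(tclassK w).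
by rewrite !taddE catA.
Qed.
Let taddC : commutative tadd.
Proof. by move=> u v; apply/tens_classP/tens_catC. Qed.
Let tadd0 : left_id tzero tadd.
Proof. by move=> u; rewrite -(tclassK u) taddE. Qed.
Let taddN : left_inverse tzero topp tadd.
Proof.
move=> u; rewrite /topp -[X in tadd _ X]tclassK taddE; apply/tens_classP.
elim: (repr u) => [|[x y] s IHs]; first exact: tens_refl.
set m := map _ s in IHs *.
apply: tens_trans (_ : tens_eqv ([:: (- x, y); (x, y)] ++ m ++ s) _).
  apply: (@tens_cat [:: (- x, y)] [:: (- x, y)] (m ++ (x, y) :: s) ((x, y) :: m ++ s)); first exact: tens_refl.
  rewrite -[(x, y) :: s]cat1s -[_ :: m ++ s]cat1s !catA.
  by apply: tens_cat; [exact: tens_catC | exact: tens_refl].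
apply: (@tens_cat _ [::] _ [::]) => //=.
apply: tens_trans (tens_zero y); apply: tens_sym.
by rewrite -[X in (X, y)](addNr x); apply: tens_addl.
Qed.

HB.instance Definition _ :=
  GRing.isZmodule.Build tensor taddA taddC tadd0 taddN.

Lemma tens_class_cat s t : tens_class (s ++ t) = tens_class s + tens_class t.
Proof. by rewrite -taddE. Qed.

Lemma tens_class_sum s : tens_class s = \sum_(p <- s) tens_pure p.1 p.2.
Proof.
elim: s => [|[x y] s IHs]; first by rewrite big_nil.
by rewrite -cat1s tens_class_cat IHs big_cons.
Qed.

Lemma tens_pureDl x x' y : tens_pure (x + x') y = tens_pure x y + tens_pure x' y.
Proof. by rewrite -tens_class_cat; apply/tens_classP/tens_addl. Qed.
Lemma tens_pureDr x y y' : tens_pure x (y + y') = tens_pure x y + tens_pure x y'.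
Proof. by rewrite -tens_class_cat; apply/tens_classP/tens_addr. Qed.
Lemma tens_pure_bal x b y : tens_pure (x <* b) y = tens_pure x (b *> y).
Proof. exact/tens_classP/tens_bal. Qed.
Lemma tens_pure0l y : tens_pure 0 y = 0.
Proof. exact/tens_classP/tens_zero. Qed.
Lemma tens_pure0r x : tens_pure x 0 = 0.
Proof. by rewrite -(lact0 (0 : B)) -tens_pure_bal ract0r tens_pure0l. Qed.

Lemma tens_liftD (G : nmodType) (phi : E -> F -> G) : balanced phi ->
  {morph tens_lift phi : u v / u + v}.
Proof.
move=> h u v; rewrite -(tclassK u) -(tclassK v) -tens_class_cat.
by rewrite !tens_lift_class // big_cat.
Qed.

Lemma tens_ind (P : tensor -> Prop) :
    P 0 -> (forall u v, P u -> P v -> P (u + v)) ->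
    (forall x y, P (tens_pure x y)) -> forall u, P u.
Proof.
move=> P0 PD Pp u; rewrite -(tclassK u) tens_class_sum.
by elim/big_ind: _ => // -[x y] _; apply: Pp.
Qed.

Lemma tens_lift0 (G : nmodType) (phi : E -> F -> G) : balanced phi ->
  tens_lift phi 0 = 0.
Proof. by move=> h; rewrite (_ : 0 = tens_class [::]) // tens_lift_class // big_nil. Qed.

Let tscale (c : R[i]) := tens_lift (fun x y => tens_pure (c *: x) y).
Let tlact (a : B) := tens_lift (fun x y => tens_pure (a *> x) y).
Let tract (u : tensor) (a : B) := tens_lift (fun x y => tens_pure x (y <* a)) u.

Let tscale_bal c : balanced (fun x y => tens_pure (c *: x) y).
Proof.
split=> [y x x'|x y y'|y|x b y].
- by rewrite scalerDr tens_pureDl.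
- exact: tens_pureDr.
- by rewrite scaler0 tens_pure0l.
- by rewrite -ractZ tens_pure_bal.
Qed.
Let tlact_bal a : balanced (fun x y => tens_pure (a *> x) y).
Proof.
split=> [y x x'|x y y'|y|x b y].
- by rewrite lactD tens_pureDl.
- exact: tens_pureDr.
- by rewrite lact0 tens_pure0l.
- by rewrite lractA tens_pure_bal.
Qed.
Let tract_bal a : balanced (fun x y => tens_pure x (y <* a)).
Proof.
split=> [y x x'|x y y'|y|x b y].
- exact: tens_pureDl.
- by rewrite ractD tens_pureDr.
- exact: tens_pure0l.
- by rewrite tens_pure_bal lractA.
Qed.

Let tscaleE c x y : tscale c (tens_pure x y) = tens_pure (c *: x) y.
Proof. exact: tens_lift_pure. Qed.
Let tlactE a x y : tlact a (tens_pure x y) = tens_pure (a *> x) y.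
Proof. exact: tens_lift_pure. Qed.
Let tractE a x y : tract (tens_pure x y) a = tens_pure x (y <* a).
Proof. exact: tens_lift_pure. Qed.
Let tscaleD c : {morph tscale c : u v / u + v}. Proof. exact: tens_liftD. Qed.
Let tlactD c : {morph tlact c : u v / u + v}. Proof. exact: tens_liftD. Qed.
Let tractD a : {morph tract^~ a : u v / u + v}. Proof. exact: tens_liftD. Qed.
Let tscale0 c : tscale c 0 = 0. Proof. exact: tens_lift0. Qed.
Let tlact0 c : tlact c 0 = 0. Proof. exact: tens_lift0. Qed.
Let tract0 c : tract 0 c = 0. Proof. exact: tens_lift0. Qed.

Let tscaleA c d u : tscale c (tscale d u) = tscale (c * d) u.
Proof.
elim/tens_ind: u => [|u v hu hv|x y]; rewrite ?tscale0 ?tscaleD ?hu ?hv //.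
by rewrite !tscaleE scalerA.
Qed.
Let tscale1 : left_id 1 tscale.
Proof.
elim/tens_ind=> [|u v hu hv|x y]; rewrite ?tscale0 ?tscaleD ?hu ?hv //.
by rewrite tscaleE scale1r.
Qed.
Let tscaleDl u : {morph tscale^~ u : c d / c + d}.
Proof.
move=> c d; elim/tens_ind: u => [|u v hu hv|x y]; rewrite ?tscale0 ?tscaleD ?addr0 //.
  by rewrite hu hv addrACA.
by rewrite !tscaleE scalerDl tens_pureDl.
Qed.

HB.instance Definition _ := GRing.Zmodule_isLmodule.Build R[i] tensor
  tscaleA tscale1 tscaleD tscaleDl.

Lemma tens_pureZl c x y : tens_pure (c *: x) y = c *: tens_pure x y.
Proof. by rewrite -tscaleE. Qed.
Lemma tens_pureZr c x y : tens_pure x (c *: y) = c *: tens_pure x y.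
Proof.
by rewrite -tens_pureZl -{1}(lact1 y) -lactZl -tens_pure_bal ractZr ract1.
Qed.

Let tlact_linear a : linear (tlact a).
Proof.
move=> c u v; rewrite tlactD; congr (_ + _).
elim/tens_ind: u => [|u w hu hw|x y].
- by rewrite scaler0 tlact0 scaler0.
- by rewrite scalerDr !tlactD hu hw scalerDr.
- by rewrite -tens_pureZl !tlactE lactZ tens_pureZl.
Qed.
Let tlact_linearl u : linear (fun a => tlact a u).
Proof.
move=> c a b; elim/tens_ind: u => [|u w hu hw|x y].
- by rewrite !tlact0 scaler0 addr0.
- by rewrite !tlactD hu hw scalerDr addrACA.
- by rewrite !tlactE lactDl lactZl tens_pureDl tens_pureZl.
Qed.
Let tract_linear a : linear (fun u => tract u a).
Proof.
move=> c u v; rewrite tractD; congr (_ + _).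
elim/tens_ind: u => [|u w hu hw|x y].
- by rewrite scaler0 tract0 scaler0.
- by rewrite scalerDr !tractD hu hw scalerDr.
- by rewrite -tens_pureZl !tractE tens_pureZl.
Qed.
Let tract_linearr u : linear (tract u).
Proof.
move=> c a b; elim/tens_ind: u => [|u w hu hw|x y].
- by rewrite !tract0 scaler0 addr0.
- by rewrite !tractD hu hw scalerDr addrACA.
- by rewrite !tractE ractDr ractZr tens_pureDr tens_pureZr.
Qed.
Let tlact1 u : tlact 1 u = u.
Proof.
elim/tens_ind: u => [|u w hu hw|x y]; first exact: tlact0.
  by rewrite tlactD hu hw.
by rewrite tlactE lact1.
Qed.
Let tract1 u : tract u 1 = u.
Proof.
elim/tens_ind: u => [|u w hu hw|x y]; first exact: tract0.
  by rewrite tractD hu hw.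
by rewrite tractE ract1.
Qed.
Let tlactA a b u : tlact (a * b) u = tlact a (tlact b u).
Proof.
elim/tens_ind: u => [|u w hu hw|x y]; first by rewrite !tlact0.
  by rewrite !tlactD hu hw.
by rewrite !tlactE lactA.
Qed.
Let tractA a b u : tract u (a * b) = tract (tract u a) b.
Proof.
elim/tens_ind: u => [|u w hu hw|x y]; first by rewrite !tract0.
  by rewrite !tractD hu hw.
by rewrite !tractE ractA.
Qed.
Let tlractA a b u : tlact a (tract u b) = tract (tlact a u) b.
Proof.
elim/tens_ind: u => [|u w hu hw|x y]; first by rewrite !(tlact0, tract0).
  by rewrite !(tlactD, tractD) hu hw.
by rewrite !(tlactE, tractE).
Qed.

HB.instance Definition _ := isBimodule.Build R B tensor
  tlact_linear tlact_linearl tract_linear tract_linearr tlact1 tract1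
  tlactA tractA tlractA.

Lemma lact_tens_pure a x y : a *> tens_pure x y = tens_pure (a *> x) y.
Proof. exact: tlactE. Qed.
Lemma ract_tens_pure a x y : tens_pure x y <* a = tens_pure x (y <* a).
Proof. exact: tractE. Qed.

End TensorProduct.

Section TensorForm.
Context {R : realType} {B : cstarAlgType R} (E F : formBimodType B).

(* <f (x) v, e (x) w> = <v, <f, e> w> *)
Let tip (u u' : tensor E F) : B :=
  tens_lift (fun f v => tens_lift (fun e w => ip v (ip f e *> w)) u') u.

Let tip_balr f v : balanced (fun (e : E) (w : F) => ip v (ip f e *> w)).
Proof.
split=> [w e e'|e w w'|w|e b w].
- by rewrite ipDr lactDl ipDr.
- by rewrite lactD ipDr.
- by rewrite ip0r lact0l ip0r.
- by rewrite ip_ract lactA.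
Qed.

Let tip_ball u' :
  balanced (fun (f : E) (v : F) => tens_lift (fun e w => ip v (ip f e *> w)) u').
Proof.
split=> [v f f'|f v v'|v|f b v]; elim/(@tens_ind _ _ E F): u' => [|u w hu hw|e w];
  rewrite ?tens_lift0 ?tens_liftD ?tens_lift_pure ?addr0 //.
- by rewrite hu hw addrACA.
- by rewrite ipDl lactDl ipDr.
- by rewrite hu hw addrACA.
- by rewrite ipDl.
- by rewrite hu hw addr0.
- by rewrite ip0l lact0l ip0r.
- by rewrite hu hw.
- by rewrite ip_ractl lactA ip_lact.
Qed.

Let tipE f v e w : tip (tens_pure f v) (tens_pure e w) = ip v (ip f e *> w).
Proof. by rewrite /tip !tens_lift_pure. Qed.
Let tipDl u u' v : tip (u + u') v = tip u v + tip u' v.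
Proof. exact: tens_liftD. Qed.
Let tip0l v : tip 0 v = 0.
Proof. exact: tens_lift0. Qed.
Let tipDr u v v' : tip u (v + v') = tip u v + tip u v'.
Proof.
elim/(@tens_ind _ _ E F): u => [|u w hu hw|e w]; first by rewrite !tip0l addr0.
  by rewrite !tipDl hu hw addrACA.
by rewrite /tip !tens_lift_pure // tens_liftD.
Qed.
Let tip0r u : tip u 0 = 0.
Proof. by apply: (addrI (tip u 0)); rewrite -tipDr !addr0. Qed.

Let tip_linear u : linear (tip u).
Proof.
move=> c v v'; rewrite tipDr; congr (_ + _).
elim/(@tens_ind _ _ E F): v => [|v w hv hw|e w]; first by rewrite !(scaler0, tip0r).
  by rewrite scalerDr !tipDr hv hw scalerDr.
elim/(@tens_ind _ _ E F): u => [|u u' hu hu'|f v]; first by rewrite !(scaler0, tip0l).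
  by rewrite !tipDl hu hu' scalerDr.
by rewrite -tens_pureZl !tipE ipZr lactZl ipZr.
Qed.
Let tip_ract u v a : tip u (v <* a) = tip u v * a.
Proof.
elim/(@tens_ind _ _ E F): v => [|v w hv hw|e w]; first by rewrite ract0 tip0r mul0r.
  by rewrite ractD !tipDr hv hw mulrDl.
elim/(@tens_ind _ _ E F): u => [|u u' hu hu'|f v]; first by rewrite !tip0l mul0r.
  by rewrite !tipDl hu hu' mulrDl.
by rewrite ract_tens_pure !tipE lractA ip_ract.
Qed.
Let tip_star u v : tip v u = star (tip u v).
Proof.
elim/(@tens_ind _ _ E F): v => [|v w hv hw|e w]; first by rewrite tip0r tip0l star0.
  by rewrite tipDl tipDr hv hw starD.
elim/(@tens_ind _ _ E F): u => [|u u' hu hu'|f v]; first by rewrite tip0r tip0l star0.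
  by rewrite tipDl tipDr hu hu' starD.
by rewrite !tipE -ip_star ip_lact -ip_star.
Qed.
Let tip_lact u v a : tip (a *> u) v = tip u (star a *> v).
Proof.
elim/(@tens_ind _ _ E F): v => [|v w hv hw|e w]; first by rewrite lact0 !tip0r.
  by rewrite lactD !tipDr hv hw.
elim/(@tens_ind _ _ E F): u => [|u u' hu hu'|f v]; first by rewrite lact0 !tip0l.
  by rewrite lactD !tipDl hu hu'.
by rewrite !lact_tens_pure !tipE ip_lact.
Qed.

HB.instance Definition _ := isFormBimodule.Build R B (tensor E F)
  tip_linear tip_ract tip_star tip_lact.

Lemma ip_tens_pure f v e w :
  ip (tens_pure f v) (tens_pure e w) = ip v (ip f e *> w) :> B.
Proof. exact: tipE. Qed.

End TensorForm.

Section DirectSum.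
Context {R : realType} {B : cstarAlgType R} {T : choiceType}.
Variable F : T -> formBimodType B.

Record dsum : Type := DSum {
  dsum_val :> forall t, F t;
  dsum_fin : exists A : {fset T}, forall t, t \notin A -> dsum_val t = 0
}.

HB.instance Definition _ := gen_eqMixin dsum.
HB.instance Definition _ := gen_choiceMixin dsum.

Implicit Types u v w : dsum.

Lemma dsumP u v : (forall t, u t = v t) -> u = v.
Proof.
case: u v => [f hf] [g hg] /= fg.
have {}fg : f = g by apply/functional_extensionality_dep.
by rewrite {}fg in hf *; congr DSum; apply: Prop_irrelevance.
Qed.

Let dmap_fin (h : forall t, F t -> F t) u : (forall t, h t 0 = 0) ->
  exists A : {fset T}, forall t, t \notin A -> h t (u t) = 0.
Proof. by move=> h0; have [A uA] := dsum_fin u; exists A => t /uA ->. Qed.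

Let dadd_fin u v :
  exists A : {fset T}, forall t, t \notin A -> u t + v t = 0.
Proof.
have [[A uA] [C vC]] := (dsum_fin u, dsum_fin v).
exists (A `|` C)%fset => t; rewrite in_fsetU negb_or => /andP[/uA -> /vC ->].
exact: addr0.
Qed.

Let dzero := @DSum (fun=> 0) (ex_intro _ fset0 (fun _ _ => erefl)).
Let dopp u := DSum (@dmap_fin (fun=> -%R) u (fun=> oppr0 _)).
Let dadd u v := DSum (dadd_fin u v).
Let dscale (c : R[i]) u := DSum (@dmap_fin (fun=> *:%R c) u (fun=> scaler0 _ c)).
Let dlact (a : B) u := DSum (@dmap_fin (fun=> lact a) u (fun=> lact0 a)).
Let dract u (a : B) := DSum (@dmap_fin (fun _ x => x <* a) u (fun=> ract0 a)).

Let daddA : associative dadd.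
Proof. by move=> u v w; apply: dsumP => t; apply: addrA. Qed.
Let daddC : commutative dadd.
Proof. by move=> u v; apply: dsumP => t; apply: addrC. Qed.
Let dadd0 : left_id dzero dadd.
Proof. by move=> u; apply: dsumP => t; apply: add0r. Qed.
Let daddN : left_inverse dzero dopp dadd.
Proof. by move=> u; apply: dsumP => t; apply: addNr. Qed.

HB.instance Definition _ :=
  GRing.isZmodule.Build dsum daddA daddC dadd0 daddN.

Let dscaleA c d u : dscale c (dscale d u) = dscale (c * d) u.
Proof. by apply: dsumP => t; apply: scalerA. Qed.
Let dscale1 : left_id 1 dscale.
Proof. by move=> u; apply: dsumP => t; apply: scale1r. Qed.
Let dscaleD : right_distributive dscale +%R.
Proof. by move=> c u v; apply: dsumP => t; apply: scalerDr. Qed.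
Let dscaleDl u : {morph dscale^~ u : c d / c + d}.
Proof. by move=> c d; apply: dsumP => t; apply: scalerDl. Qed.

HB.instance Definition _ := GRing.Zmodule_isLmodule.Build R[i] dsum
  dscaleA dscale1 dscaleD dscaleDl.

Lemma dsum0E t : (0 : dsum) t = 0. Proof. by []. Qed.
Lemma dsumDE u v t : (u + v) t = u t + v t. Proof. by []. Qed.
Lemma dsumZE c u t : (c *: u) t = c *: u t. Proof. by []. Qed.

Let dlact_linear a : linear (dlact a).
Proof. by move=> c u v; apply: dsumP => t; apply: lact_linear. Qed.
Let dlact_linearl u : linear (fun a => dlact a u).
Proof. by move=> c a b; apply: dsumP => t; apply: lact_linearl. Qed.
Let dract_linear a : linear (fun u => dract u a).
Proof. by move=> c u v; apply: dsumP => t; apply: ract_linear. Qed.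
Let dract_linearr u : linear (dract u).
Proof. by move=> c a b; apply: dsumP => t; apply: ract_linearr. Qed.
Let dlact1 u : dlact 1 u = u.
Proof. by apply: dsumP => t; apply: lact1. Qed.
Let dract1 u : dract u 1 = u.
Proof. by apply: dsumP => t; apply: ract1. Qed.
Let dlactA a b u : dlact (a * b) u = dlact a (dlact b u).
Proof. by apply: dsumP => t; apply: lactA. Qed.
Let dractA a b u : dract u (a * b) = dract (dract u a) b.
Proof. by apply: dsumP => t; apply: ractA. Qed.
Let dlractA a b u : dlact a (dract u b) = dract (dlact a u) b.
Proof. by apply: dsumP => t; apply: lractA. Qed.

HB.instance Definition _ := isBimodule.Build R B dsum
  dlact_linear dlact_linearl dract_linear dract_linearr dlact1 dract1
  dlactA dractA dlractA.

Lemma dsum_lactE a u t : (a *> u) t = a *> u t. Proof. by []. Qed.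
Lemma dsum_ractE a u t : (u <* a) t = u t <* a. Proof. by []. Qed.

Section Lift.
Variable G : nmodType.

Definition dsum_lift (phi : forall t, F t -> G) (u : dsum) : G :=
  \sum_(t \in [set: T]) phi t (u t).

Lemma dsum_liftE phi u (A : {fset T}) : (forall t, phi t 0 = 0) ->
    (forall t, t \notin A -> u t = 0) ->
  dsum_lift phi u = \sum_(t <- A) phi t (u t).
Proof.
by move=> phi0 uA; apply: fsbigTE => t /uA ->; apply: phi0.
Qed.

Lemma dsum_lift0 phi : (forall t, phi t 0 = 0) -> dsum_lift phi 0 = 0.
Proof. by move=> phi0; apply: fsbig1 => t _; apply: phi0. Qed.

Lemma dsum_liftD phi : (forall t, phi t 0 = 0) ->
    (forall t, {morph phi t : x y / x + y}) ->
  {morph dsum_lift phi : u v / u + v}.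
Proof.
move=> phi0 phiD u v.
have [[A uA] [C vC]] := (dsum_fin u, dsum_fin v).
have uAC t : t \notin (A `|` C)%fset -> u t = 0 /\ v t = 0.
  by rewrite in_fsetU negb_or => /andP[/uA -> /vC ->].
rewrite !(@dsum_liftE _ _ (A `|` C)%fset) //; last 3 first.
- by move=> t /uAC[].
- by move=> t /uAC[].
- by move=> t /uAC[]; rewrite dsumDE => -> ->; apply: addr0.
by rewrite -big_split; apply: eq_bigr => t _; apply: phiD.
Qed.

End Lift.

Let dip u v : B := \sum_(t \in [set: T]) ip (u t) (v t).

Let dip_lift u : dip u = dsum_lift (fun t => ip (u t)). Proof. by []. Qed.

Let dipE u v (A : {fset T}) : (forall t, t \notin A -> v t = 0) ->
  dip u v = \sum_(t <- A) ip (u t) (v t).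
Proof. by move=> vA; rewrite dip_lift (@dsum_liftE _ _ _ A) // => t; apply: ip0r. Qed.

Let dip_linear u : linear (dip u).
Proof.
move=> c v w; rewrite dip_lift dsum_liftD; last 2 first.
- by move=> t; apply: ip0r.
- by move=> t x y; apply: ipDr.
congr (_ + _); have [A vA] := dsum_fin v.
rewrite -dip_lift !(@dipE _ _ A) //.
  by rewrite scaler_sumr; apply: eq_bigr => t _; rewrite -ipZr.
by move=> t /vA; rewrite dsumZE => ->; apply: scaler0.
Qed.
Let dip_ract u v a : dip u (v <* a) = dip u v * a.
Proof.
have [A vA] := dsum_fin v; rewrite !(@dipE _ _ A) //.
  by rewrite mulr_suml; apply: eq_bigr => t _; rewrite -ip_ract.
by move=> t /vA; rewrite dsum_ractE => ->; apply: ract0.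
Qed.
Let dip_star u v : dip v u = star (dip u v).
Proof.
have [[A uA] [C vC]] := (dsum_fin u, dsum_fin v).
rewrite !(@dipE _ _ (A `|` C)%fset); last 2 first.
- by move=> t; rewrite in_fsetU negb_or => /andP[_ /vC].
- by move=> t; rewrite in_fsetU negb_or => /andP[/uA].
by rewrite star_sum; apply: eq_bigr => t _; apply: ip_star.
Qed.
Let dip_lact u v a : dip (a *> u) v = dip u (star a *> v).
Proof.
have [A vA] := dsum_fin v; rewrite !(@dipE _ _ A) //.
  by apply: eq_bigr => t _; apply: ip_lact.
by move=> t /vA; rewrite dsum_lactE => ->; apply: lact0.
Qed.

HB.instance Definition _ := isFormBimodule.Build R B dsum
  dip_linear dip_ract dip_star dip_lact.

Lemma ip_dsumE u v : ip u v = \sum_(t \in [set: T]) ip (u t) (v t).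
Proof. by []. Qed.

Definition dsum_inj_fun (t : T) (x : F t) (t' : T) : F t' :=
  if @eqP _ t t' is ReflectT e then ecast t (F t) e x else 0.

Fact dsum_inj_fin t (x : F t) :
  exists A : {fset T}, forall t', t' \notin A -> dsum_inj_fun x t' = 0.
Proof.
exists [fset t]%fset => t'; rewrite in_fset1 /dsum_inj_fun.
by move/eqP => ne; case: eqP => // e; case: ne.
Qed.

Definition dsum_inj (t : T) (x : F t) : dsum := DSum (dsum_inj_fin x).

Lemma dsum_injE t (x : F t) : dsum_inj x t = x.
Proof.
by rewrite /= /dsum_inj_fun; case: eqP => // e; rewrite eq_axiomK.
Qed.

Lemma dsum_inj_neq t t' (x : F t) : t != t' -> dsum_inj x t' = 0.
Proof. by rewrite /= /dsum_inj_fun; case: eqP. Qed.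

Lemma dsum_injD t (x y : F t) : dsum_inj (x + y) = dsum_inj x + dsum_inj y.
Proof.
apply: dsumP => t'; rewrite dsumDE; have [<-|ne] := eqVneq t t'.
  by rewrite !dsum_injE.
by rewrite !dsum_inj_neq ?addr0.
Qed.

Lemma dsum_inj0 t : dsum_inj (0 : F t) = 0.
Proof. by apply: (addrI (@dsum_inj t 0)); rewrite -dsum_injD !addr0. Qed.

Lemma dsum_inj_ract t (x : F t) a : dsum_inj (x <* a) = dsum_inj x <* a.
Proof.
apply: dsumP => t'; rewrite dsum_ractE; have [<-|ne] := eqVneq t t'.
  by rewrite !dsum_injE.
by rewrite !dsum_inj_neq ?ract0.
Qed.

Lemma dsum_inj_lact t (x : F t) a : dsum_inj (a *> x) = a *> dsum_inj x.
Proof.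
apply: dsumP => t'; rewrite dsum_lactE; have [<-|ne] := eqVneq t t'.
  by rewrite !dsum_injE.
by rewrite !dsum_inj_neq ?lact0.
Qed.

Lemma dsum_lift_inj (G : nmodType) (phi : forall t, F t -> G) t (x : F t) :
  (forall t, phi t 0 = 0) -> dsum_lift phi (dsum_inj x) = phi t x.
Proof.
move=> phi0; rewrite (@dsum_liftE _ _ _ [fset t]%fset) //.
  by rewrite big_seq_fset1 dsum_injE.
by move=> t'; rewrite in_fset1 => ne; rewrite dsum_inj_neq // eq_sym.
Qed.

End DirectSum.

Section RightLinear.
Context {R : realType} {B : cstarAlgType R}.

(* Linearity over R[i] follows, as c *: x = x <* c%:A. *)
Definition right_linear (E F : bimodType B) (X : E -> F) :=
  {morph X : x y / x + y} /\ forall x b, X (x <* b) = X x <* b.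

Lemma right_linear0 (E F : bimodType B) (X : E -> F) :
  right_linear X -> X 0 = 0.
Proof. by case=> XD _; apply: (addrI (X 0)); rewrite -XD !addr0. Qed.

Lemma right_linearZ (E F : bimodType B) (X : E -> F) c x :
  right_linear X -> X (c *: x) = c *: X x.
Proof.
by case=> _ Xr; rewrite -{1}(ract1 x) -ractZr Xr ractZr ract1.
Qed.

Lemma right_linear_zero (E F : bimodType B) : right_linear (fun _ : E => 0 : F).
Proof. by split=> [x y|x b]; rewrite ?addr0 ?ract0. Qed.

Lemma right_linear_comp (E F G : bimodType B) (X : F -> G) (Y : E -> F) :
  right_linear X -> right_linear Y -> right_linear (X \o Y).
Proof. by move=> [XD Xr] [YD Yr]; split=> [x y|x b] /=; rewrite ?YD ?Yr. Qed.

Lemma right_linear_inj (T : choiceType) (F : T -> formBimodType B) t :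
  right_linear (@dsum_inj _ _ _ F t).
Proof. by split; [apply: dsum_injD | apply: dsum_inj_ract]. Qed.

Lemma right_linear_lift (T : choiceType) (F : T -> formBimodType B)
    (G : bimodType B) (phi : forall t, F t -> G) :
  (forall t, right_linear (phi t)) -> right_linear (dsum_lift phi).
Proof.
move=> h; have phi0 t : phi t 0 = 0 by apply: right_linear0.
split=> [|u b]; first by apply: dsum_liftD => // t; apply: (h t).1.
have [A uA] := dsum_fin u; rewrite !(@dsum_liftE _ _ _ _ _ _ _ A) //.
  by rewrite ract_sum; apply: eq_bigr => t _; apply: (h t).2.
by move=> t /uA; rewrite dsum_ractE => ->; apply: ract0.
Qed.

Variable M : bimodType B.

Record rend : Type := REnd { rend_fun :> M -> M; rendP : right_linear rend_fun }.

HB.instance Definition _ := gen_eqMixin rend.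
HB.instance Definition _ := gen_choiceMixin rend.

Implicit Types X Y Z : rend.

Lemma rend_eqP X Y : (forall x, X x = Y x) -> X = Y.
Proof.
case: X Y => [f hf] [g hg] /= fg.
have {}fg : f = g by apply/funext.
by rewrite {}fg in hf *; congr REnd; apply: Prop_irrelevance.
Qed.

Let radd_subproof X Y : right_linear (fun x => X x + Y x).
Proof.
have [[XD Xr] [YD Yr]] := (rendP X, rendP Y).
by split=> [x y|x b]; rewrite ?XD ?YD ?Xr ?Yr ?ractD // addrACA.
Qed.
Let rscale_subproof (c : R[i]) X : right_linear (fun x => c *: X x).
Proof.
have [XD Xr] := rendP X.
by split=> [x y|x b]; rewrite ?XD ?Xr ?scalerDr ?ractZ.
Qed.
Let rone_subproof : right_linear (@id M). Proof. by split. Qed.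
Let lop_subproof (a : B) : right_linear (lact a : M -> M).
Proof. by split=> [x y|x b]; rewrite ?lactD ?lractA. Qed.

Let rzero := REnd (right_linear_zero M M).
Let radd X Y := REnd (radd_subproof X Y).
Let rscale c X := REnd (rscale_subproof c X).
Let ropp X := rscale (- 1) X.
Let rone := REnd rone_subproof.
Let rmul X Y := REnd (right_linear_comp (rendP X) (rendP Y)).

Let raddA : associative radd.
Proof. by move=> X Y Z; apply: rend_eqP => x; apply: addrA. Qed.
Let raddC : commutative radd.
Proof. by move=> X Y; apply: rend_eqP => x; apply: addrC. Qed.
Let radd0 : left_id rzero radd.
Proof. by move=> X; apply: rend_eqP => x; apply: add0r. Qed.
Let raddN : left_inverse rzero ropp radd.
Proof. by move=> X; apply: rend_eqP => x /=; rewrite scaleN1r addNr. Qed.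

HB.instance Definition _ := GRing.isZmodule.Build rend raddA raddC radd0 raddN.

Let rmulA : associative rmul.
Proof. by move=> X Y Z; apply: rend_eqP. Qed.
Let rmul1l : left_id rone rmul.
Proof. by move=> X; apply: rend_eqP. Qed.
Let rmul1r : right_id rone rmul.
Proof. by move=> X; apply: rend_eqP. Qed.
Let rmulDl : left_distributive rmul +%R.
Proof. by move=> X Y Z; apply: rend_eqP. Qed.
Let rmulDr : right_distributive rmul +%R.
Proof. by move=> X Y Z; apply: rend_eqP => x; apply: (rendP X).1. Qed.

HB.instance Definition _ := GRing.Zmodule_isPzRing.Build rend
  rmulA rmul1l rmul1r rmulDl rmulDr.

Let rscaleA c d X : rscale c (rscale d X) = rscale (c * d) X.
Proof. by apply: rend_eqP => x; apply: scalerA. Qed.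
Let rscale1 : left_id 1 rscale.
Proof. by move=> X; apply: rend_eqP => x; apply: scale1r. Qed.
Let rscaleD : right_distributive rscale +%R.
Proof. by move=> c X Y; apply: rend_eqP => x; apply: scalerDr. Qed.
Let rscaleDl X : {morph rscale^~ X : c d / c + d}.
Proof. by move=> c d; apply: rend_eqP => x; apply: scalerDl. Qed.

HB.instance Definition _ := GRing.Zmodule_isLmodule.Build R[i] rend
  rscaleA rscale1 rscaleD rscaleDl.

Definition lmul_op (a : B) : rend := REnd (lop_subproof a).

Lemma rend0E x : (0 : rend) x = 0. Proof. by []. Qed.
Lemma rend1E x : (1 : rend) x = x. Proof. by []. Qed.
Lemma rendDE X Y x : (X + Y) x = X x + Y x. Proof. by []. Qed.
Lemma rendME X Y x : (X * Y) x = X (Y x). Proof. by []. Qed.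
Lemma rendZE c X x : (c *: X) x = c *: X x. Proof. by []. Qed.

Definition subalgebra (S : set rend) :=
  [/\ S 0,
      forall (c : R[i]) X Y, S X -> S Y -> S (c *: X + Y)
    & forall X Y, S X -> S Y -> S (X * Y)].

End RightLinear.

Section MonotoneIndependence.
Context {R : realType} {B : cstarAlgType R} {M : bimodType B}.
Context {d : Order.disp_t} {J : orderType d}.

(* In the third clause the chains are i_1 < ... < i_m and k_1 < ... < k_n with
   i_1 < k_1, and rev_ord puts the factors X_{i_m}, ..., X_{i_1} in this order;
   B is embedded in the operators on M by left multiplication. *)
Definition monotone_independent (S : J -> set (rend M)) (Phi : rend M -> B) :=
  [/\ forall j, subalgebra (S j),
      forall (i j k : J), (i < j)%O -> (k < j)%O ->
        forall Xi Xj Xk A C : rend M, S i Xi -> S j Xj -> S k Xk ->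
          Phi (A * Xi * Xj * Xk * C) = Phi (A * Xi * lmul_op M (Phi Xj) * Xk * C)
    & forall (m n : nat) (i : 'I_m.+1 -> J) (k : 'I_n.+1 -> J),
        {homo i : p q / (p < q)%N >-> (p < q)%O} ->
        {homo k : p q / (p < q)%N >-> (p < q)%O} ->
        (i ord0 < k ord0)%O ->
        forall (X : 'I_m.+1 -> rend M) (Y : 'I_n.+1 -> rend M),
          (forall p, S (i p) (X p)) -> (forall q, S (k q) (Y q)) ->
          [/\ Phi (\prod_p X (rev_ord p)) = \prod_p Phi (X (rev_ord p)),
              Phi (\prod_q Y q) = \prod_q Phi (Y q)
            & Phi ((\prod_p X (rev_ord p)) * \prod_q Y q) =
                (\prod_p Phi (X (rev_ord p))) * \prod_q Phi (Y q)]].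

End MonotoneIndependence.

HB.instance Definition _ (d : Order.disp_t) (T : orderType d) (A : set T) :=
  SubChoice.on (set_type A).
HB.instance Definition _ (d : Order.disp_t) (T : orderType d) (A : set T) :=
  [SubChoice_isSubOrder of set_type A by <: with d].

Section WeaklyMonotone.
Context {R : realType} {B : cstarAlgType R} {d : Order.disp_t} {J : orderType d}.
Variable E : J -> semiInnerBimodType B.

Fixpoint tens (s : seq J) : formBimodType B :=
  match s with
  | [::] => self_bimod B
  | i :: s' =>
      match s' with
      | [::] => E i
      | _ :: _ => tensor (E i) (tens s')
      end
  end.

Definition wmonotone (s : seq J) : bool := sorted >=%O s.

Definition wm : formBimodType B :=
  dsum (fun s : {s : seq J | wmonotone s} => tens (val s)).

(* 0 when s is not weakly decreasing. *)
Definition wm_inj (s : seq J) : tens s -> wm :=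
  match pselect (wmonotone s) with
  | left h => @dsum_inj _ _ _ _ (exist _ s h)
  | right _ => fun=> 0
  end.

Definition vacuum : wm := @wm_inj [::] (1 : B).

Section Operators.
Context {i : J} (f : E i).

Definition tens_create (s : seq J) : tens s -> tens (i :: s) :=
  match s return tens s -> tens (i :: s) with
  | [::] => fun b : B => f <* b
  | _ :: _ => fun x => tens_pure f x
  end.

Definition tens_annihilate (s : seq J) : tens (i :: s) -> tens s :=
  match s return tens (i :: s) -> tens s with
  | [::] => fun e : E i => ip f e
  | _ :: _ => tens_lift (fun e x => ip f e *> x)
  end.

Definition create_fun (s : {s : seq J | wmonotone s}) : tens (val s) -> wm :=
  fun x =>
    if (if val s is i1 :: _ then (i1 <= i)%O else true)
    then @wm_inj (i :: val s) (tens_create x) else 0.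

End Operators.

Definition annihilate_summand (i : J) (f : E i) (s : seq J) : tens s -> wm :=
  match s return tens s -> wm with
  | [::] => fun=> 0
  | i1 :: s' => fun x =>
      if @eqP _ i i1 is ReflectT e
      then wm_inj (tens_annihilate (ecast i (E i) e f) x) else 0
  end.

Definition annihilate_fun (i : J) (f : E i) (s : {s : seq J | wmonotone s}) :
  tens (val s) -> wm := @annihilate_summand i f (val s).

Lemma tens_create_right_linear i (f : E i) s : right_linear (@tens_create i f s).
Proof.
case: s => [|j s]; split=> [x y|x b] /=.
- exact: ractDr.
- exact: ractA.
- exact: tens_pureDr.
- by rewrite ract_tens_pure.
Qed.

Lemma annihilate_balanced (F : bimodType B) i (f : E i) :
  balanced (fun (e : E i) (x : F) => ip f e *> x).
Proof.
split=> [x e e'|e x x'|x|e b x].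
- by rewrite ipDr lactDl.
- exact: lactD.
- by rewrite ip0r lact0l.
- by rewrite ip_ract lactA.
Qed.

Lemma tens_annihilate_right_linear i (f : E i) s :
  right_linear (@tens_annihilate i f s).
Proof.
case: s => [|j s]; split=> [x y|x b].
- exact: ipDr.
- exact: ip_ract.
- exact/tens_liftD/annihilate_balanced.
- rewrite /tens_annihilate.
  have h := annihilate_balanced (tens (j :: s)) f.
  elim/(@tens_ind _ _ (E i) (tens (j :: s))): x => [|u v hu hv|e x].
  + by rewrite ract0 tens_lift0 // ract0.
  + by rewrite ractD !tens_liftD // ractD hu hv.
  + by rewrite ract_tens_pure !tens_lift_pure // lractA.
Qed.

Lemma wm_inj_right_linear s : right_linear (@wm_inj s).
Proof.
rewrite /wm_inj; case: pselect => [h|_].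
  exact: (@right_linear_inj _ _ _ (fun s : {s | wmonotone s} => tens (val s))
    (exist _ s h)).
exact: right_linear_zero.
Qed.

Lemma create_fun_right_linear i (f : E i) s : right_linear (@create_fun i f s).
Proof.
rewrite /create_fun; case: (if val s is i1 :: _ then (i1 <= i)%O else true); last exact: right_linear_zero.
exact: (right_linear_comp (@wm_inj_right_linear (i :: val s))
  (tens_create_right_linear f (val s))).
Qed.

Lemma annihilate_fun_right_linear i (f : E i) s :
  right_linear (@annihilate_fun i f s).
Proof.
rewrite /annihilate_fun; case: s => -[|j s] hs /=; first exact: right_linear_zero.
case: eqP => [e|_]; last exact: right_linear_zero.
exact: (right_linear_comp (@wm_inj_right_linear s)
  (@tens_annihilate_right_linear j (ecast i (E i) e f) s)).
Qed.

Definition creation (i : J) (f : E i) : rend wm :=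
  REnd (right_linear_lift (create_fun_right_linear f)).

Definition annihilation (i : J) (f : E i) : rend wm :=
  REnd (right_linear_lift (annihilate_fun_right_linear f)).

Definition gaussian (i : J) (f : E i) : rend wm := annihilation f + creation f.

(* b_0 G(f_1) b_1 ... G(f_n) b_n for w = [:: (f_1, b_1); ...; (f_n, b_n)] *)
Definition gaussian_word (i : J) (b0 : B) (w : seq (E i * B)) : rend wm :=
  lmul_op wm b0 * \prod_(p <- w) (gaussian p.1 * lmul_op wm p.2).

Definition gaussian_algebra (i : J) : set (rend wm) :=
  [set X | exists (N : nat) (c : 'I_N -> R[i]) (b : 'I_N -> B)
             (w : 'I_N -> seq (E i * B)),
      (forall k, 0 < size (w k))%N /\
      X = \sum_k c k *: gaussian_word (b k) (w k)].

Definition vacuum_expectation (X : rend wm) : B := ip vacuum (X vacuum).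

End WeaklyMonotone.

Section ElementaryTensors.
Context {R : realType} {B : cstarAlgType R} {d : Order.disp_t} {J : orderType d}.
Variable E : J -> semiInnerBimodType B.

Fixpoint etens (l : seq {i : J & E i}) : tens E (map tag l) :=
  match l return tens E (map tag l) with
  | [::] => (1 : B)
  | e :: l' =>
      match l' return tens E (map tag l') -> tens E (tag e :: map tag l') with
      | [::] => fun=> tagged e
      | _ :: _ => fun x => tens_pure (tagged e) x
      end (etens l')
  end.

Definition wm_etens l : wm E := wm_inj (etens l).

Lemma wm_etens_nil : wm_etens [::] = vacuum E. Proof. by []. Qed.

Lemma wm_inj_wmonotone s (hs : wmonotone s) (x : tens E s) :
  wm_inj x = dsum_inj (F := fun s : {s | wmonotone s} => tens E (val s))
    (t := exist _ s hs) x.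
Proof.
by rewrite /wm_inj; case: pselect => // h; rewrite (Prop_irrelevance h hs).
Qed.

Lemma creation_inj i (f : E i) s (x : tens E s) : wmonotone s ->
  creation f (wm_inj x) =
    if (if s is i1 :: _ then (i1 <= i)%O else true)
    then wm_inj (tens_create f x) else 0.
Proof.
move=> hs; rewrite (wm_inj_wmonotone hs) /= dsum_lift_inj // => t.
exact: right_linear0 (create_fun_right_linear f t).
Qed.

Lemma annihilation_inj i (f : E i) s (x : tens E s) : wmonotone s ->
  annihilation f (wm_inj x) = annihilate_summand f x.
Proof.
move=> hs; rewrite (wm_inj_wmonotone hs) /= dsum_lift_inj // => t.
exact: right_linear0 (annihilate_fun_right_linear f t).
Qed.

Lemma creation_etens_nil i (f : E i) :
  creation f (wm_etens [::]) = wm_etens [:: Tagged E f].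
Proof. by rewrite creation_inj //= ract1. Qed.

Lemma creation_etens_cons i (f : E i) e l : wmonotone (map tag (e :: l)) ->
  creation f (wm_etens (e :: l)) =
    if (tag e <= i)%O then wm_etens [:: Tagged E f, e & l] else 0.
Proof. by move=> hs; rewrite creation_inj. Qed.

Lemma annihilation_etens_nil i (f : E i) : annihilation f (wm_etens [::]) = 0.
Proof. by rewrite annihilation_inj. Qed.

Lemma wm_inj_lact s a (x : tens E s) : wm_inj (a *> x) = a *> wm_inj x.
Proof.
rewrite /wm_inj; case: pselect => [h|_]; last by rewrite lact0.
exact: dsum_inj_lact.
Qed.

Lemma annihilation_etens_eq i (f e : E i) l :
    wmonotone (i :: map tag l) ->
  annihilation f (wm_etens (Tagged E e :: l)) = ip f e *> wm_etens l.
Proof.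
move=> hs; rewrite annihilation_inj //=; case: eqP => // h.
rewrite eq_axiomK /=; case: l hs => [|e' l] hs /=.
  by rewrite -wm_inj_lact /= [in RHS]/lact /= mulr1.
rewrite -wm_inj_lact tens_lift_pure //; exact: annihilate_balanced.
Qed.

Lemma annihilation_etens_neq i (f : E i) e l : wmonotone (map tag (e :: l)) ->
  i != tag e -> annihilation f (wm_etens (e :: l)) = 0.
Proof. by move=> hs ne; rewrite annihilation_inj //=; case: eqP ne. Qed.

End ElementaryTensors.

(* Main.v *)
Require Import Defs.
From mathcomp Require Import all_boot all_order all_algebra finmap.
From mathcomp Require Import complex all_classical reals.

(** Everything follows from two facts about an operator [X] of the algebra
    [A_j] acting on the weakly monotone product.

    First, [X] kills every vector supported on index tuples whose first index
    is larger than [j] ([gaussian_algebra_gt0]), and its range is supported on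
    the empty tuple and the tuples with first index at most [j]
    ([gaussian_algebra_supported]). Every word in [A_j] contains at least one
    [G(f)] with [f] in [E_j]: [a^*(f)] and [a(f)] both vanish on a first index
    larger than [j], and neither creates nor uncovers one.

    Secondly, if all first indices in [u] are smaller than [j], then
    [X u = Phi(X) u + r], where [r] is supported on tuples that start with [j]
    ([gaussian_algebra_split]). Morally the operators of [A_j] act on
    [F (x) u], where [F] is the full Fock space of [E_j], through the left
    factor, and [X 1 = Phi(X) 1 + ...] there. The tensor splitting is never
    constructed. Instead [X] is normally ordered: on the vectors [u] in
    question [a(f)] vanishes, and [a(f) a^*(g)] is multiplication by [<f, g>]
    on vectors with first indices at most [j], so [X] agrees with a
    [B]-combination of products of creation operators. Such a combination is
    an element of [B] plus operators that begin by creating a vector of [E_j],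
    and the element of [B] is read off at [u = 1].

    For [i < j > k] the vector [X_k v] has first indices at most [k < j], so
    [X_j X_k v = Phi(X_j) X_k v + r], and [X_i] kills [r]: this is the peak
    condition, as an identity of operators. Along an increasing product
    [X_{k_1} ... X_{k_n} 1], each factor [X_{k_q}] that has a factor of smaller
    index on its left may be replaced in the same way by [Phi(X_{k_q})],
    starting with the rightmost one, and since [b 1 = 1 b], right linearity moves that coefficient out of the product on
    the right. Along a decreasing product the correction terms [r] are
    orthogonal to the vacuum, so the expectations factor out on the left. *)

Set Implicit Arguments.
Unset Strict Implicit.
Unset Printing Implicit Defensive.

Import Order.TTheory GRing.Theory.

Local Open Scope ring_scope.

Section WeaklyMonotoneFock.
Context {R : realType} {B : cstarAlgType R} {d : Order.disp_t} {J : orderType d}.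
Variable E : J -> semiInnerBimodType B.
Notation wmE := (wm E).
Notation summand := (fun t : {s : seq J | wmonotone s} => tens E (val t)).
Notation vac := (vacuum E).
Notation Phi := (@vacuum_expectation R B d J E).
Notation alg := (@gaussian_algebra R B d J E).
Implicit Types (i j k : J) (s : seq J) (u v w : wmE) (X Y Z : rend wmE).

(** * Vectors supported on a set of index tuples *)

Definition supported (p : pred (seq J)) u :=
  forall t : {s : seq J | wmonotone s}, ~~ p (val t) -> u t = 0.

(** The empty tuple, that is the summand [B], counts as lying below every
    index, but neither at nor above one. *)
Definition head_lt j : pred (seq J) :=
  fun s => if s is i :: _ then (i < j)%O else true.
Definition head_le j : pred (seq J) :=
  fun s => if s is i :: _ then (i <= j)%O else true.
Definition head_eq j : pred (seq J) :=
  fun s => if s is i :: _ then i == j else false.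
Definition head_gt j : pred (seq J) :=
  fun s => if s is i :: _ then (j < i)%O else false.

Lemma supported0 p : supported p 0.
Proof. by []. Qed.

Lemma supportedD p u v : supported p u -> supported p v -> supported p (u + v).
Proof. by move=> pu pv t pt; rewrite dsumDE pu // pv // addr0. Qed.

Lemma supported_lact p b u : supported p u -> supported p (b *> u).
Proof. by move=> pu t pt; rewrite dsum_lactE pu // lact0. Qed.

Lemma supportedS (p q : pred (seq J)) u :
  {subset p <= q} -> supported p u -> supported q u.
Proof. by move=> pq pu t qt; apply: pu; apply: contra qt; apply: pq. Qed.

Lemma supported_inj (p : pred (seq J)) s (x : tens E s) :
  p s -> supported p (wm_inj x).
Proof.
move=> ps; case: (boolP (wmonotone s)) => hs; last first.
  by rewrite /wm_inj; case: pselect => // h; rewrite h in hs.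
rewrite (wm_inj_wmonotone hs) => t pt.
apply: (@dsum_inj_neq _ _ _ summand (exist _ s hs)).
by apply: contraNneq pt => <-.
Qed.

Let wm_sumE (I : eqType) (r : seq I) (F : I -> wmE) t :
  (\sum_(z <- r) F z : wmE) t = \sum_(z <- r) F z t.
Proof. by elim/big_rec2: _ => // z x y _ <-; rewrite dsumDE. Qed.

Lemma wm_sum_inj u : u = dsum_lift (@dsum_inj R B _ summand) u.
Proof.
have [A uA] := dsum_fin u; apply: dsumP => t.
rewrite (@dsum_liftE _ _ _ _ _ _ _ A) //; last by move=> t'; apply: dsum_inj0.
rewrite wm_sumE; have [tA|tA] := boolP (t \in A); last first.
  rewrite uA // big1_seq // => t' /andP[_ t'A].
  apply: (@dsum_inj_neq _ _ _ summand).
  by apply: contraNneq tA => <-.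
rewrite (bigD1_seq t) ?fset_uniq // (@dsum_injE _ _ _ summand).
rewrite big1 => [|t' ne]; first by rewrite /= addr0.
exact: (@dsum_inj_neq _ _ _ summand).
Qed.

(** A vector is the finite sum of its components, so an additive property of
    the vectors supported on [p] need only be checked on single summands. *)
Lemma supported_ind (p : pred (seq J)) (P : wmE -> Prop) :
    P 0 -> (forall u v, P u -> P v -> P (u + v)) ->
    (forall s (x : tens E s), wmonotone s -> p s -> P (wm_inj x)) ->
  forall u, supported p u -> P u.
Proof.
move=> P0 PD Pi u pu; have [A uA] := dsum_fin u; rewrite [u]wm_sum_inj.
rewrite (@dsum_liftE _ _ _ _ _ _ _ A) //; last by move=> t; apply: dsum_inj0.
elim/big_ind: _ => // t _; have [pt|pt] := boolP (p (val t)); last first.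
  by rewrite pu // dsum_inj0.
case: t pt => s hs /= ps.
by rewrite -(wm_inj_wmonotone hs (u (exist _ s hs))); apply: Pi.
Qed.

Lemma wm_ind (P : wmE -> Prop) :
    P 0 -> (forall u v, P u -> P v -> P (u + v)) ->
    (forall s (x : tens E s), wmonotone s -> P (wm_inj x)) ->
  forall u, P u.
Proof.
move=> P0 PD Pi u; apply: (@supported_ind predT P) => // s x hs _; exact: Pi.
Qed.

Lemma head_le_monotone i s : wmonotone s -> head_le i s -> wmonotone (i :: s).
Proof. by case: s => //= j s hs ij; rewrite /wmonotone /= ij. Qed.

Lemma monotone_head_le i s : wmonotone (i :: s) -> head_le i s.
Proof. by case: s => //= j s /andP[]. Qed.

(** * The vacuum functional *)

Lemma vacuum_supported (p : pred (seq J)) : p [::] -> supported p vac.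
Proof. exact: supported_inj. Qed.

Lemma lact_vacuum b : b *> vac = vac <* b.
Proof.
rewrite -wm_inj_lact -(wm_inj_right_linear E [::]).2; congr wm_inj.
by rewrite /lact /ract /= mulr1 mul1r.
Qed.

Lemma ip_vacuum_vacuum : ip vac vac = 1.
Proof.
have h0 : wmonotone ([::] : seq J) by [].
rewrite /vacuum (wm_inj_wmonotone h0) ip_dsumE.
(* With its first argument fixed, the form is the lift of its components. *)
rewrite -[LHS]/(dsum_lift (fun t => ip (dsum_inj _ t)) (dsum_inj _)).
rewrite dsum_lift_inj => [|t]; last exact: ip0r.
by rewrite dsum_injE /ip /= star1 mulr1.
Qed.

Lemma ip_vacuum_lact b u : ip vac (b *> u) = b * ip vac u.
Proof. by rewrite -{1}(starK b) -ip_lact lact_vacuum ip_ractl starK. Qed.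

Lemma ip_vacuum_eq0 (p : pred (seq J)) u :
  ~~ p [::] -> supported p u -> ip vac u = 0.
Proof.
move=> p0 pu; have h0 : wmonotone ([::] : seq J) by [].
rewrite ip_dsumE; apply: fsbig1 => t _.
have [et|et] := eqVneq (exist _ [::] h0) t.
  by rewrite pu ?ip0r // -et.
by rewrite /vacuum (wm_inj_wmonotone h0) dsum_inj_neq // ip0l.
Qed.

(** * Creation, annihilation and left multiplication *)

Lemma rendD X u v : X (u + v) = X u + X v.
Proof. exact: (rendP X).1. Qed.

Lemma rend_ract X u b : X (u <* b) = X u <* b.
Proof. exact: (rendP X).2. Qed.

Lemma rend0 X : X 0 = 0.
Proof. exact: right_linear0 (rendP X). Qed.

Lemma creation_supported i (f : E i) u : supported (head_eq i) (creation f u).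
Proof.
elim/wm_ind: u => [|u v hu hv|s x hs].
- by rewrite rend0.
- by rewrite rendD; apply: supportedD.
- rewrite creation_inj //; case: ifP => // _.
  by apply: supported_inj; rewrite /= eqxx.
Qed.

Lemma annihilation_supported i (f : E i) u :
  supported (head_le i) (annihilation f u).
Proof.
elim/wm_ind: u => [|u v hu hv|s x hs].
- by rewrite rend0.
- by rewrite rendD; apply: supportedD.
- rewrite annihilation_inj //; case: s x hs => [|j s] x hs //=.
  case: eqP => // e; apply: supported_inj; apply: monotone_head_le.
  by rewrite e.
Qed.

Lemma creation_gt0 i (f : E i) u : supported (head_gt i) u -> creation f u = 0.
Proof.
elim/supported_ind=> [|{}u v hu hv|s x hs].
- exact: rend0.
- by rewrite rendD hu hv addr0.
- rewrite creation_inj //; case: s x hs => //= j s x hs.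
  by rewrite ltNge => /negbTE ->.
Qed.

Lemma annihilation_neq0 i (f : E i) u :
  supported (fun s => ~~ head_eq i s) u -> annihilation f u = 0.
Proof.
elim/supported_ind=> [|{}u v hu hv|s x hs].
- exact: rend0.
- by rewrite rendD hu hv addr0.
- rewrite annihilation_inj //; case: s x hs => //= j s x hs ij.
  by case: eqP => // e; rewrite /in_mem /= -e eqxx in ij.
Qed.

(** Here [creation g] prepends [g], which [annihilation f] contracts again. The
    support condition is essential: [creation g] kills a vector whose first
    indices are larger than [i]. *)
Lemma annihilation_creation i (f g : E i) u :
  supported (head_le i) u -> annihilation f (creation g u) = ip f g *> u.
Proof.
elim/supported_ind=> [|{}u v hu hv|s x hs si].
- by rewrite !rend0 lact0.
- by rewrite !rendD hu hv lactD.
- have his := head_le_monotone hs si.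
  rewrite creation_inj //; move: (si); rewrite /head_le.
  case: s x hs si his => [|j s] x hs si his => [_|->];
    rewrite annihilation_inj //=; case: eqP => // e;
    rewrite eq_axiomK /= -wm_inj_lact.
    by rewrite ip_ract.
  by rewrite tens_lift_pure //; apply: annihilate_balanced.
Qed.

Lemma lmul_creation i (f : E i) b :
  lmul_op wmE b * creation f = creation (b *> f).
Proof.
apply: rend_eqP => u; rewrite rendME -[LHS]/(b *> creation f u).
elim/wm_ind: u => [|u v hu hv|s x hs].
- by rewrite !rend0 lact0.
- by rewrite !rendD lactD hu hv.
- rewrite !creation_inj //; case: ifP => _; last by rewrite lact0.
  rewrite -wm_inj_lact; congr wm_inj; case: s x {hs} => [|j s] x /=.
    exact: lractA.
  exact: lact_tens_pure.
Qed.

Lemma lmulM b c : lmul_op wmE (b * c) = lmul_op wmE b * lmul_op wmE c.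
Proof. by apply: rend_eqP => u; apply: lactA. Qed.

Lemma scale_lmul a b : a *: lmul_op wmE b = lmul_op wmE (a *: b).
Proof. by apply: rend_eqP => u; rewrite rendZE -lactZl. Qed.

(** * The algebras generated by the gaussian operators *)

Lemma gaussian_algebra_word i b (w : seq (E i * B)) :
  (0 < size w)%N -> alg i (gaussian_word b w).
Proof.
move=> w0; exists 1%N, (fun=> 1), (fun=> b), (fun=> w); split=> //.
by rewrite big_ord1 scale1r.
Qed.

Lemma gaussian_algebra0 i : alg i 0.
Proof.
by exists 0%N, (fun=> 0), (fun=> 0), (fun=> [::]); split=> [[]//|]; rewrite big_ord0.
Qed.

Lemma gaussian_algebraD i X Y : alg i X -> alg i Y -> alg i (X + Y).
Proof.
move=> [m [c [b [w [w0 ->]]]]] [n [c' [b' [w' [w0' ->]]]]].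
pose cat T (f : 'I_m -> T) (g : 'I_n -> T) (k : 'I_(m + n)) :=
  match fintype.split k with inl p => f p | inr q => g q end.
exists (m + n)%N, (cat _ c c'), (cat _ b b'), (cat _ w w'); split.
  by move=> k; rewrite /cat; case: fintype.split.
rewrite big_split_ord; congr (_ + _); apply: eq_bigr => k _; rewrite /cat.
  by rewrite -[lshift n k]/(unsplit (inl k)) unsplitK.
by rewrite -[rshift m k]/(unsplit (inr k)) unsplitK.
Qed.

(** Scalars are absorbed by the first coefficient, so sums of words already
    exhaust the linear span. *)
Lemma gaussian_wordZ i c b (w : seq (E i * B)) :
  c *: gaussian_word b w = gaussian_word (c *: b) w.
Proof.
by apply: rend_eqP => u; rewrite /gaussian_word -scale_lmul.
Qed.

Lemma gaussian_algebra_ind i (P : rend wmE -> Prop) :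
    P 0 -> (forall X Y, P X -> P Y -> P (X + Y)) ->
    (forall b (w : seq (E i * B)), (0 < size w)%N -> P (gaussian_word b w)) ->
  forall X, alg i X -> P X.
Proof.
move=> P0 PD Pw X [N [c [b [w [w0 ->]]]]].
by elim/big_ind: _ => // k _; rewrite gaussian_wordZ; apply: Pw.
Qed.

(** The two coefficients that meet in the middle merge; they have a Gaussian
    operator to their left because the first word is not empty. *)
Lemma gaussian_wordM i b b' (w w' : seq (E i * B)) : (0 < size w)%N ->
  exists2 w'' : seq (E i * B), (0 < size w'')%N &
    gaussian_word b w * gaussian_word b' w' = gaussian_word b w''.
Proof.
case/lastP: w => // w [f c] _; exists (rcons w (f, c * b') ++ w').
  by rewrite size_cat size_rcons.
by rewrite /gaussian_word -!cats1 !big_cat !big_seq1 /= lmulM !mulrA.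
Qed.

Lemma gaussian_algebra_subalgebra i : subalgebra (alg i).
Proof.
split=> [|c X Y hX hY|X Y hX hY]; first exact: gaussian_algebra0.
  apply: gaussian_algebraD hY.
  move: X hX; apply: gaussian_algebra_ind => [|X Y' hX hY|b w w0].
  - by rewrite scaler0; apply: gaussian_algebra0.
  - by rewrite scalerDr; apply: gaussian_algebraD.
  - by rewrite gaussian_wordZ; apply: gaussian_algebra_word.
move: X hX; apply: gaussian_algebra_ind => [|X X' hX hX'|b w w0].
- by rewrite mul0r; apply: gaussian_algebra0.
- by rewrite mulrDl; apply: gaussian_algebraD.
move: Y hY; apply: gaussian_algebra_ind => [|Y Y' hY hY'|b' w' w0'].
- by rewrite mulr0; apply: gaussian_algebra0.
- by rewrite mulrDr; apply: gaussian_algebraD.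
have [w'' w0'' ->] := gaussian_wordM b b' w' w0.
exact: gaussian_algebra_word.
Qed.

Lemma gaussian_supported i (f : E i) u : supported (head_le i) (gaussian f u).
Proof.
rewrite rendDE; apply: supportedD; first exact: annihilation_supported.
apply: supportedS (creation_supported f u) => -[|j s] //= /eqP ->.
exact: lexx.
Qed.

Lemma gaussian_gt0 i (f : E i) u : supported (head_gt i) u -> gaussian f u = 0.
Proof.
move=> hu; rewrite rendDE creation_gt0 // addr0 annihilation_neq0 //.
by apply: supportedS hu => -[|j s] //= ij; rewrite /in_mem /= gt_eqF.
Qed.

(** The leftmost Gaussian operator of a word determines its range. *)
Lemma gaussian_algebra_supported i X u :
  alg i X -> supported (head_le i) (X u).
Proof.
move=> hX; move: X hX; apply: gaussian_algebra_ind => [|X Y hX hY|b [//|[f c] w] _].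
- exact: supported0.
- exact: supportedD.
- rewrite /gaussian_word big_cons !rendME; apply: supported_lact.
  exact: gaussian_supported.
Qed.

(** The rightmost Gaussian operator of a word acts first, up to a left
    multiplication, and kills the vector. This is where words without Gaussian
    operators, the elements of [B], have to be excluded. *)
Lemma gaussian_algebra_gt0 i X u :
  alg i X -> supported (head_gt i) u -> X u = 0.
Proof.
move=> hX hu; move: X hX; apply: gaussian_algebra_ind => [|X Y hX hY|b w w0] //.
  by rewrite rendDE hX hY addr0.
case/lastP: w w0 => // w [f c] _.
rewrite /gaussian_word -cats1 big_cat big_seq1 !rendME gaussian_gt0 ?rend0 //.
exact: supported_lact.
Qed.

(** * Normal ordering *)

(** The normally ordered operators. Products [b a^*(f)] need no clause of
    their own, since [b a^*(f) = a^*(b f)] by [lmul_creation]. *)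
Inductive creation_form j : rend wmE -> Prop :=
| creation_form_lmul b : creation_form j (lmul_op wmE b)
| creation_formD Y Z :
    creation_form j Y -> creation_form j Z -> creation_form j (Y + Z)
| creation_formM (f : E j) Z :
    creation_form j Z -> creation_form j (creation f * Z).

Lemma creation_form_supported j Z u :
  creation_form j Z -> supported (head_lt j) u -> supported (head_le j) (Z u).
Proof.
move=> hZ hu; elim: hZ => [b|Y {}Z _ hY _ hZ|f {}Z _ _].
- apply: supported_lact; apply: supportedS hu => -[|i s] //; exact: ltW.
- exact: supportedD.
- apply: supportedS (creation_supported f (Z u)) => -[|i s] //= /eqP ->.
  exact: lexx.
Qed.

Lemma creation_form_lmulM j Z b :
  creation_form j Z -> creation_form j (lmul_op wmE b * Z).
Proof.
elim=> [c|Y {}Z _ hY _ hZ|f {}Z hZ _].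
- by rewrite -lmulM; apply: creation_form_lmul.
- by rewrite mulrDr; apply: creation_formD.
- by rewrite mulrA lmul_creation; apply: creation_formM.
Qed.

(** An annihilation operator is absorbed by the creation operator next to it,
    or, if there is none, it meets a vector without component at [j] in its
    first place and vanishes. *)
Lemma annihilation_creation_form j (f : E j) Z : creation_form j Z ->
  exists2 Z', creation_form j Z' &
    forall u, supported (head_lt j) u -> annihilation f (Z u) = Z' u.
Proof.
elim=> [b|Y {}Z _ [Y' hY' YE] _ [Z' hZ' ZE]|g {}Z hZ _].
- exists (lmul_op wmE 0); first exact: creation_form_lmul.
  move=> u hu; rewrite -[RHS]/(0 *> u) lact0l; apply: annihilation_neq0.
  apply: supported_lact.
  by apply: supportedS hu => -[|i s] //= ij; rewrite /in_mem /= lt_eqF.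
- exists (Y' + Z'); first exact: creation_formD.
  by move=> u hu; rewrite !rendDE rendD YE // ZE.
- exists (lmul_op wmE (ip f g) * Z); first exact: creation_form_lmulM.
  move=> u hu; rewrite !rendME annihilation_creation //.
  exact: creation_form_supported.
Qed.

Lemma gaussian_word_creation_form j b (w : seq (E j * B)) :
  exists2 Z, creation_form j Z &
    forall u, supported (head_lt j) u -> gaussian_word b w u = Z u.
Proof.
rewrite /gaussian_word; elim: w b => [|[f c] w IHw] b.
  exists (lmul_op wmE b); first exact: creation_form_lmul.
  by rewrite big_nil mulr1.
have [Z hZ ZE] := IHw c; have [Z' hZ' ZE'] := annihilation_creation_form f hZ.
exists (lmul_op wmE b * (Z' + creation f * Z)).
  by apply: creation_form_lmulM; apply: creation_formD => //; apply: creation_formM.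
move=> u hu; rewrite big_cons -(mulrA (gaussian f)) rendME (rendME (gaussian f)).
by rewrite ZE // !rendME !rendDE ZE'.
Qed.

(** The coefficient [b] does not depend on the vector [u], so that it can be
    computed from the vacuum. *)
Lemma creation_form_split j Z : creation_form j Z ->
  exists b, forall u, supported (head_lt j) u ->
    exists2 r, supported (head_eq j) r & Z u = b *> u + r.
Proof.
elim=> [b|Y {}Z _ [b hb] _ [c hc]|f {}Z _ _].
- by exists b => u _; exists 0; rewrite ?addr0.
- exists (b + c) => u hu; have [r hr YE] := hb u hu; have [q hq ZE] := hc u hu.
  exists (r + q); first exact: supportedD.
  by rewrite rendDE YE ZE lactDl addrACA.
- exists 0 => u _; exists (creation f (Z u)); first exact: creation_supported.
  by rewrite lact0l add0r.
Qed.

Lemma gaussian_algebra_creation_form j X : alg j X ->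
  exists2 Z, creation_form j Z & forall u, supported (head_lt j) u -> X u = Z u.
Proof.
move: X; apply: gaussian_algebra_ind => [|X Y [Z hZ ZE] [Z' hZ' ZE']|b w _].
- exists (lmul_op wmE 0); first exact: creation_form_lmul.
  by move=> u _; rewrite /= lact0l.
- exists (Z + Z'); first exact: creation_formD.
  by move=> u hu; rewrite !rendDE ZE // ZE'.
- exact: gaussian_word_creation_form.
Qed.

(** The vacuum is itself a vector with first indices smaller than [j], and the
    remainder is orthogonal to it: this identifies the coefficient in
    [creation_form_split] as the expectation of [X]. *)
Lemma gaussian_algebra_split j X u : alg j X -> supported (head_lt j) u ->
  exists2 r, supported (head_eq j) r & X u = Phi X *> u + r.
Proof.
move=> hX hu; have [Z hZ ZE] := gaussian_algebra_creation_form hX.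
have [b hb] := creation_form_split hZ.
suff -> : Phi X = b by rewrite ZE //; apply: hb.
have hvac : supported (head_lt j) vac by exact: vacuum_supported.
have [r hr] := hb vac hvac; rewrite /vacuum_expectation ZE // => ->.
by rewrite ipDr ip_vacuum_lact ip_vacuum_vacuum mulr1 (ip_vacuum_eq0 _ hr) ?addr0.
Qed.

(** * Monotone independence *)

Lemma head_le_lt i j : (i < j)%O -> {subset head_le i <= head_lt j}.
Proof. by move=> ij [|k s] //= ki; apply: le_lt_trans ki ij. Qed.

(** The remainder of [Y u] starts with [j], which is larger than [i], and is
    therefore killed by [X]. *)
Lemma gaussian_algebra_peak i j X Y u :
    (i < j)%O -> alg i X -> alg j Y -> supported (head_lt j) u ->
  X (Y u) = X (Phi Y *> u).
Proof.
move=> ij hX hY hu; have [r hr ->] := gaussian_algebra_split hY hu.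
rewrite rendD [X r](gaussian_algebra_gt0 hX) ?addr0 //.
by apply: supportedS hr => -[|k s] //= /eqP ->.
Qed.

Lemma vacuum_expectation_mul j X u : alg j X -> supported (head_lt j) u ->
  ip vac (X u) = Phi X * ip vac u.
Proof.
move=> hX hu; have [r hr ->] := gaussian_algebra_split hX hu.
by rewrite ipDr ip_vacuum_lact (ip_vacuum_eq0 _ hr) ?addr0.
Qed.

(** The operator [X] of smaller index on the left is what removes the
    remainders. It is an arbitrary one so that the induction can use the first
    factor of the product in its place. *)
Lemma increasing_prod_vacuum n (k : 'I_n -> J) (Y : 'I_n -> rend wmE) i X :
    {homo k : p q / (p < q)%N >-> (p < q)%O} ->
    (forall q, i < k q)%O -> alg i X -> (forall q, alg (k q) (Y q)) ->
  X ((\prod_q Y q) vac) = X vac <* \prod_q Phi (Y q).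
Proof.
elim: n k Y i X => [|n IHn] k Y i X kinc ik hX hY.
  by rewrite !big_ord0 ract1.
rewrite !big_ord_recl rendME ractA.
rewrite (IHn (k \o lift ord0) (Y \o lift ord0) (k ord0) (Y ord0)) //=; last 2 first.
- by move=> p q pq; apply: kinc.
- by move=> q; apply: kinc.
rewrite rend_ract; congr (_ <* _).
rewrite (gaussian_algebra_peak (ik ord0) hX (hY ord0)); last exact: vacuum_supported.
by rewrite lact_vacuum rend_ract.
Qed.

Lemma rev_ord_max m : rev_ord (@ord_max m) = ord0.
Proof. by apply: val_inj; rewrite /= subnn. Qed.

(** The induction removes the factor that acts first, the one of smallest
    index: its output lies below all the remaining indices, and is the next
    vector [u]. *)
Lemma decreasing_prod_ip m (i : 'I_m -> J) (X : 'I_m -> rend wmE) u :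
    {homo i : p q / (p < q)%N >-> (p < q)%O} ->
    (forall p, alg (i p) (X p)) -> (forall p, supported (head_lt (i p)) u) ->
  ip vac ((\prod_p X (rev_ord p)) u) = (\prod_p Phi (X (rev_ord p))) * ip vac u.
Proof.
elim: m i X u => [|m IHm] i X u iinc hX hu; first by rewrite !big_ord0 mul1r.
have revE (p : 'I_m) : rev_ord (widen_ord (leqnSn m) p) = lift ord0 (rev_ord p).
  by apply: val_inj; rewrite /= /bump /= subSS add1n subnSK.
rewrite !big_ord_recr rev_ord_max rendME /=.
under eq_bigr do rewrite revE.
rewrite (IHm (i \o lift ord0) (X \o lift ord0)) //=; last 2 first.
- by move=> p q pq; apply: iinc.
- move=> p; apply: supportedS (gaussian_algebra_supported u (hX ord0)).
  by apply: head_le_lt; apply: iinc.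
rewrite (vacuum_expectation_mul (hX ord0) (hu ord0)) mulrA.
by under [in RHS]eq_bigr do rewrite revE.
Qed.

Lemma weakly_monotone_independent : monotone_independent alg Phi.
Proof.
split=> [j|i j k ij kj Xi Xj Xk A C hi hj hk|m n i k iinc kinc ik X Y hX hY].
- exact: gaussian_algebra_subalgebra.
- rewrite /vacuum_expectation !rendME; congr (ip vac (A _)).
  apply: (gaussian_algebra_peak ij hi hj).
  exact: supportedS (head_le_lt kj) (gaussian_algebra_supported _ hk).
have decr : Phi (\prod_p X (rev_ord p)) = \prod_p Phi (X (rev_ord p)).
  rewrite /vacuum_expectation (decreasing_prod_ip iinc hX) ?ip_vacuum_vacuum ?mulr1 //.
  by move=> p; apply: vacuum_supported.
have tailE j Z : (forall q, j < k q)%O -> alg j Z ->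
    Z ((\prod_q Y q) vac) = Z vac <* \prod_q Phi (Y q).
  by move=> jk hZ; apply: increasing_prod_vacuum kinc jk hZ hY.
have kge q : (k ord0 <= k q)%O.
  by have [->//|q0] := eqVneq q ord0; apply/ltW/kinc; rewrite lt0n.
split=> //.
- rewrite !big_ord_recl /vacuum_expectation rendME.
  rewrite (@increasing_prod_vacuum _ (k \o lift ord0) (Y \o lift ord0) (k ord0)) //=.
  + by rewrite ip_ract.
  + by move=> p q pq; apply: kinc.
  + by move=> q; apply: kinc.
- rewrite -decr /vacuum_expectation big_ord_recr rev_ord_max !rendME.
  (* X_{i_1} acts directly on the increasing product, and i_1 < k_1. *)
  rewrite (tailE (i ord0)) ?rend_ract ?ip_ract //.
  by move=> q; apply: lt_le_trans ik (kge q).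
Qed.

End WeaklyMonotoneFock.

Theorem theorem4p4 (R : realType) (B : cstarAlgType R) (I : set int)
    (E : I -> semiInnerBimodType B) :
  monotone_independent (fun i : I => @gaussian_algebra R B _ _ E i)
    (@vacuum_expectation R B _ _ E).
Proof. exact: weakly_monotone_independent. Qed.
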